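(* Let $l=A_1\ldots A_m$ be a closed polygonal line and $p=Q_1\ldots Q_n$ a (non-closed) polygonal line in the plane such that the points $A_1,\ldots,A_m,Q_1,\ldots,Q_n$ are pairwise distinct and in general position. Denote by $P_0=Q_1$ and $P_1=Q_n$ the initial and final points of $p$. Then: (a) $w(l,P_1)-w(l,P_0)=l\cdot p$. (b) $w(l,P_1)=l\cdot p$ if $P_0$ is sufficiently far from $l$ (for instance, whenever $P_0$ lies outside the convex hull of $l$).
   Context: All points are in the plane $\mathbb{R}^2$. For points $A,B\neq O$ (possibly $A=B$), the oriented angle $\angle AOB$ is the number $t\in(-\pi,\pi]$ such that $\overrightarrow{OB}$ is a positive multiple of the vector obtained from $\overrightarrow{OA}$ by counterclockwise rotation through $t$. A polygonal line is an ordered tuple of points; the oriented edges of $Q_1\ldots Q_n$ are $\overrightarrow{Q_jQ_{j+1}}$, $1\le j\le n-1$. A closed polygonal line $A_1\ldots A_m$ is an ordered tuple of points, whose oriented edges are $\overrightarrow{A_iA_{i+1}}$, $1\le i\le m$, where $A_{m+1}:=A_1$. The winding number of a closed polygonal line $l=A_1\ldots A_m$ around a point $O$ not on it is $w(l,O):=\frac{1}{2\pi}\sum_{i=1}^{m}\angle A_iOA_{i+1}$. Points are in general position if no three of them are collinear and no three (distinct) segments joining them have a common interior point. If no three of $A,B,C,D$ are collinear and the oriented segments $\overrightarrow{AB}$ and $\overrightarrow{CD}$ intersect, the sign of their intersection point is $+1$ if $ABC$ is traversed clockwise, and $-1$ otherwise. $l\cdot p$ is the sum of the signs of the intersection points of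 $l$ and $p$, i.e. the sum, over all pairs consisting of an oriented edge $\overrightarrow{AB}$ of $l$ and an oriented edge $\overrightarrow{CD}$ of $p$ that intersect, of the sign of the intersection point of $\overrightarrow{AB}$ and $\overrightarrow{CD}$. *)

(* Defs.v *)
From HB Require Import structures.
From mathcomp Require Import all_boot all_order all_algebra.
From mathcomp Require Import boolp classical_sets reals trigo convex.

Set Implicit Arguments.
Unset Strict Implicit.
Unset Printing Implicit Defensive.

Import Order.TTheory GRing.Theory Num.Theory.

Local Open Scope classical_set_scope.
Local Open Scope ring_scope.

Notation plane R := 'rV[R]_2.

Section Plane.
Variable R : realType.
Implicit Types (A B C D O X : plane R) (S : set (plane R)).

(* The norm of 'rV[R]_2 in the library is the sup norm. *)
Definition dist A B : R :=
  Num.sqrt ((A 0 0 - B 0 0) ^+ 2 + (A 0 1 - B 0 1) ^+ 2).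

(* Counterclockwise rotation of the vector v through t. *)
Definition rotate (t : R) (v : plane R) : plane R :=
  \row_(j < 2) (if j == 0 then cos t * v 0 0 - sin t * v 0 1
                else sin t * v 0 0 + cos t * v 0 1).

(* The oriented angle AOB; such a t exists and is unique if A, B <> O.
   The value is irrelevant otherwise. *)
Definition angle A O B : R :=
  xget 0 [set t : R | - pi < t <= pi /\
                      exists2 k : R, 0 < k & B - O = k *: rotate t (A - O)].

Definition segment A B : set (plane R) :=
  [set X | exists2 t : R, 0 <= t <= 1 & X = A + t *: (B - A)].

Definition segment_interior A B : set (plane R) :=
  [set X | exists2 t : R, 0 < t < 1 & X = A + t *: (B - A)].

Definition line X (v : plane R) : set (plane R) :=
  [set Y | exists t : R, Y = X + t *: v].

Definition collinear A B C : Prop :=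
  exists X v, [/\ v != 0, line X v A, line X v B & line X v C].

(* Since segments are compared as sets of points, [A, B] and [B, A] are the
   same segment. *)
Definition general_position S : Prop :=
  (forall A B C, S A -> S B -> S C ->
     A <> B -> B <> C -> A <> C -> ~ collinear A B C) /\
  (forall A B C D E F, S A -> S B -> S C -> S D -> S E -> S F ->
     A <> B -> C <> D -> E <> F ->
     segment A B <> segment C D -> segment C D <> segment E F ->
     segment A B <> segment E F ->
     ~ exists X, [/\ segment_interior A B X, segment_interior C D X &
                     segment_interior E F X]).

(* Negative orientation of the triangle ABC: det (B - A, C - A) < 0. *)
Definition clockwise A B C : bool :=
  (B 0 0 - A 0 0) * (C 0 1 - A 0 1) - (B 0 1 - A 0 1) * (C 0 0 - A 0 0) < 0.

Definition crossing_sign A B C : int := if clockwise A B C then 1 else -1.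

(* Edges of the polygonal line Q_1 ... Q_n; zip drops the unmatched Q_n. *)
Definition edges (p : seq (plane R)) : seq (plane R * plane R) :=
  zip p (behead p).

(* Edges of the closed polygonal line A_1 ... A_m, including (A_m, A_1). *)
Definition closed_edges (l : seq (plane R)) : seq (plane R * plane R) :=
  zip l (rot 1 l).

Definition winding (l : seq (plane R)) O : R :=
  (2 * pi)^-1 * \sum_(e <- closed_edges l) angle e.1 O e.2.

(* The intersection number of l (closed) and p (not closed). *)
Definition intersection_number (l p : seq (plane R)) : int :=
  \sum_(e <- closed_edges l) \sum_(f <- edges p)
    if `[< segment e.1 e.2 `&` segment f.1 f.2 !=set0 >]
    then crossing_sign e.1 e.2 f.1 else 0.

(* The closed polygonal line l as a subset of the plane. *)
Definition polygon (l : seq (plane R)) : set (plane R) :=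
  [set X | exists2 e, e \in closed_edges l & segment e.1 e.2 X].

Definition convex_hull S : set (plane R) :=
  smallest (@convex_set R (plane R)) S.

End Plane.

(* Main.v *)
Require Import Defs.
From mathcomp Require Import all_boot all_order all_algebra.
From mathcomp Require Import boolp classical_sets reals trigo convex.
From mathcomp Require Import interval_inference ring lra.

(** Along an edge PQ of p, the winding number changes by the sum, over the edges
    AB of l, of (AQB - APB) / 2pi (oriented angles).  The oriented angles of the
    quadrilateral APBQ add up to 2pi times the sign of the crossing of its
    diagonals AB and PQ, and to 0 if these do not cross.  The two angles APB and
    BQA thus contribute the crossing sign up to the difference PBQ - PAQ, and
    the latter telescopes around the closed line l.  This gives (a).
    For (b), a point outside the convex hull of l is separated from the vertices
    of l by a line.  All of them are then seen under angles in (-pi/2, pi/2)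
    from the normal of this line, so the angles of the edges telescope to 0. *)

Set Implicit Arguments.
Unset Strict Implicit.
Unset Printing Implicit Defensive.

Import Order.TTheory GRing.Theory Num.Theory.

Local Open Scope classical_set_scope.
Local Open Scope ring_scope.

(** * Oriented angles between vectors *)

Section Vectors.
Variable R : realType.
Implicit Types (u v w : plane R) (t k : R).

Lemma row2P u v : u 0 0 = v 0 0 -> u 0 1 = v 0 1 -> u = v.
Proof.
move=> u0 u1; apply/rowP => -[[|[|//]] i].
- by rewrite (_ : Ordinal i = 0) //; apply: val_inj.
- by rewrite (_ : Ordinal i = 1) //; apply: val_inj.
Qed.

Definition dot u v : R := u 0 0 * v 0 0 + u 0 1 * v 0 1.
Definition cross u v : R := u 0 0 * v 0 1 - u 0 1 * v 0 0.

Lemma dot_gt0 u : u != 0 -> 0 < dot u u.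
Proof.
move=> u0; rewrite /dot -!expr2 lt_def addr_ge0 ?sqr_ge0 // andbT.
rewrite paddr_eq0 ?sqr_ge0 // !sqrf_eq0; apply: contra u0 => /andP[/eqP a /eqP b].
by apply/eqP/row2P; rewrite !mxE.
Qed.

Lemma cross_neq0 u v : cross u v != 0 -> u != 0 /\ v != 0.
Proof.
by move=> c; split; apply: contraNneq c => ->; rewrite /cross !mxE; apply/eqP; ring.
Qed.

(** The body repeats that of [angle] with free vectors in place of differences, so that [angleE]
    holds by conversion. *)
Definition vangle u v : R :=
  xget 0 [set t : R | - pi < t <= pi /\ exists2 k : R, 0 < k & v = k *: rotate t u].

Lemma angleE A O B : @angle R A O B = vangle (A - O) (B - O).
Proof. by []. Qed.

Lemma polar_angle (c s : R) : c ^+ 2 + s ^+ 2 = 1 ->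
  exists t, [/\ - pi < t, t <= pi, cos t = c & sin t = s].
Proof.
move=> cs1; have c1 : -1 <= c <= 1 by apply/andP; split; nra.
have [s0|s0] := leP 0 s.
- exists (acos c); split.
  + by rewrite (lt_le_trans _ (acos_ge0 c1)) // oppr_lt0 pi_gt0.
  + exact: acos_lepi.
  + by rewrite acosK.
  + by rewrite sin_acos // (_ : 1 - _ = s ^+ 2) ?sqrtr_sqr ?ger0_norm //; lra.
- exists (- acos c); split.
  (* Here [s < 0] forces [c ^+ 2 < 1], so [acos c] is not [pi] and the lower bound is strict. *)
  + rewrite ltrN2 acos_ltpi //; apply/andP; split; nra.
  + by rewrite (le_trans _ (pi_ge0 R)) // oppr_le0 acos_ge0.
  + by rewrite cosN acosK.
  + rewrite sinN sin_acos // (_ : 1 - _ = s ^+ 2) ?sqrtr_sqr ?ltr0_norm ?opprK //; lra.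
Qed.

(** Since [k * dot u u] is positive, the signs of [dot u v] and [cross u v] are those of the cosine
    and sine of the angle; the bounds on angles below all come from this. *)
Lemma vangleP u v : u != 0 -> v != 0 ->
  [/\ - pi < vangle u v, vangle u v <= pi &
   exists2 k, 0 < k & [/\ v = k *: rotate (vangle u v) u,
     dot u v = k * dot u u * cos (vangle u v) &
     cross u v = k * dot u u * sin (vangle u v)]].
Proof.
move=> u0 v0.
have E k t : v = k *: rotate t u -> [/\ v = k *: rotate t u,
     dot u v = k * dot u u * cos t & cross u v = k * dot u u * sin t].
  by move=> ->; split=> //; rewrite /dot /cross !mxE /=; ring.
suff [t tpi [k k0 vE]] : exists2 t : R, - pi < t <= pi &
    exists2 k : R, 0 < k & v = k *: rotate t u.
  have [/andP[? ?] [k' k'0 /E vE']] : [set t : R | - pi < t <= pi /\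
      exists2 k : R, 0 < k & v = k *: rotate t u] (vangle u v).
    by apply: xgetPex; exists t; split=> //; exists k.
  by split=> //; exists k'.
have uu := dot_gt0 u0; have vv := dot_gt0 v0.
(* [N] is the product of the two lengths. By Lagrange's identity, [dot u v / N] and [cross u v / N]
   are the coordinates of a point on the unit circle. *)
set N := Num.sqrt (dot u u * dot v v).
have N0 : 0 < N by rewrite sqrtr_gt0 mulr_gt0.
have N2 : N ^+ 2 = dot u u * dot v v by rewrite sqr_sqrtr // mulr_ge0 // ltW.
have [|t [t1 t2 ct st]] := @polar_angle (dot u v / N) (cross u v / N).
  have E2 : dot u v ^+ 2 + cross u v ^+ 2 = N ^+ 2.
    by rewrite N2 /dot /cross; ring.
  by rewrite !expr_div_n -mulrDl E2 divff // expf_neq0 // gt_eqF.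
exists t; first by rewrite t1.
exists (N / dot u u); first by rewrite divr_gt0.
have N0' := lt0r_neq0 N0; have uu' := lt0r_neq0 uu.
clearbody N; move: uu'; rewrite /dot /cross => uu'.
by apply: row2P; rewrite !mxE /= ct st /dot /cross; field; rewrite N0' uu'.
Qed.

(** Equality is allowed: parallel vectors make the angle 0 or [pi], never [- pi]. *)
Lemma vangle_ge0 u v : u != 0 -> v != 0 -> 0 <= cross u v -> 0 <= vangle u v.
Proof.
move=> u0 v0; have [t1 t2 [k k0 [_ _ ->]]] := vangleP u0 v0.
rewrite pmulr_rge0 ?mulr_gt0 ?dot_gt0 // => st; rewrite leNgt; apply/negP => t0.
have : 0 < sin (- vangle u v) by apply: sin_gt0_pi; apply/andP; split; lra.
by rewrite sinN; lra.
Qed.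

Lemma vangle_gt0 u v : 0 < cross u v -> 0 < vangle u v < pi.
Proof.
move=> c; have [u0 v0] := cross_neq0 (lt0r_neq0 c).
have := vangle_ge0 u0 v0 (ltW c); move: c.
have [t1 t2 [k k0 [_ _ ->]]] := vangleP u0 v0.
rewrite pmulr_rgt0 ?mulr_gt0 ?dot_gt0 // => st t0.
rewrite !lt_neqAle t0 t2 !andbT; apply/andP; split.
  by apply: contraTneq st => <-; rewrite sin0 ltxx.
by apply: contraTneq st => ->; rewrite sinpi ltxx.
Qed.

Lemma vangle_lt0 u v : cross u v < 0 -> - pi < vangle u v < 0.
Proof.
move=> c; have [u0 v0] := cross_neq0 (ltr0_neq0 c); move: c.
have [t1 t2 [k k0 [_ _ ->]]] := vangleP u0 v0.
rewrite pmulr_rlt0 ?mulr_gt0 ?dot_gt0 // => st; rewrite t1 /= ltNge.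
apply/negP => t0.
have : 0 <= sin (vangle u v) by apply: sin_ge0_pi; rewrite t0.
by lra.
Qed.

Lemma vangle_lt_pihalf u v : u != 0 -> 0 < dot u v -> - (pi / 2) < vangle u v < pi / 2.
Proof.
move=> u0 d; have v0 : v != 0.
  by apply: contraTneq d => ->; rewrite /dot !mxE !mulr0 addr0 ltxx.
move: d; have [t1 t2 [k k0 [_ -> _]]] := vangleP u0 v0.
rewrite pmulr_rgt0 ?mulr_gt0 ?dot_gt0 // => ct.
have pi0 := pi_gt0 R; apply/andP; split; rewrite ltNge; apply/negP => h.
  (* Shifting by [pi / 2] turns the cosine into minus a sine, whose sign is known on [[0, pi]]. *)
  have := @sin_ge0_pi R (- vangle u v - pi / 2).
  rewrite sinBpihalf cosN oppr_ge0 => /(_ _)/le_gtF; rewrite ct => H.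
  by have: true = false by apply: H; apply/andP; split; lra.
have := @sin_ge0_pi R (vangle u v - pi / 2).
rewrite sinBpihalf oppr_ge0 => /(_ _)/le_gtF; rewrite ct => H.
by have: true = false by apply: H; apply/andP; split; lra.
Qed.

(** Rotating from [u] via [v] to [w] and rotating directly give the same direction, so the angles
    agree modulo [2 * pi]; a cosine equal to 1 says so without naming the integer. *)
Lemma cos_vangleD u v w : u != 0 -> v != 0 -> w != 0 ->
  cos (vangle u v + vangle v w - vangle u w) = 1.
Proof.
move=> u0 v0 w0; have uu := dot_gt0 u0.
have [_ _ [k k0 [vE _ _]]] := vangleP u0 v0.
have [_ _ [h h0 [wE _ _]]] := vangleP v0 w0.
have [_ _ [m m0 [_ wd wc]]] := vangleP u0 w0.
set r := vangle u v in vE *; set s := vangle v w in wE *.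
set t := vangle u w in wd wc *.
set a := h * k * dot u u; set b := m * dot u u in wd wc.
have a0 : 0 < a by rewrite !mulr_gt0.
have b0 : 0 < b by rewrite !mulr_gt0.
have cE : a * cos (r + s) = b * cos t.
  by rewrite -wd wE vE /a cosD /dot !mxE /=; ring.
have sE : a * sin (r + s) = b * sin t.
  by rewrite -wc wE vE /a sinD /dot /cross !mxE /=; ring.
(* Adding the squares of [cE] and [sE] gives [a ^+ 2 = b ^+ 2]. *)
have abE : a = b.
  apply/eqP; rewrite -(@eqrXn2 _ 2) ?ltW //; apply/eqP.
  rewrite -[a ^+ 2]mulr1 -[b ^+ 2]mulr1 -{1}(cos2Dsin2 (r + s)) -(cos2Dsin2 t).
  by rewrite !mulrDr -!exprMn cE sE.
rewrite abE in cE sE; have b0' := lt0r_neq0 b0.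
by rewrite cosB (mulfI b0' cE) (mulfI b0' sE) -!expr2 cos2Dsin2.
Qed.

(** [1 - cos t] is twice the square of [sin (t / 2)], and sine has no zero strictly between 0 and
    [pi]. *)
Lemma cos_eq1 t : - (2 * pi) < t < 2 * pi -> cos t = 1 -> t = 0.
Proof.
move=> /andP[t1 t2] c.
have s0 : sin (t / 2) = 0.
  have : cos ((t / 2) *+ 2) = 1 by rewrite -[RHS]c -[_ *+ 2]mulr_natr divfK // pnatr_eq0.
  rewrite cos_mulr2n cos2sin2 mulr2n => h.
  by apply/eqP; rewrite -(@sqrf_eq0 R); apply/eqP; lra.
have [t0|t0|//] := ltgtP t 0.
  have : 0 < sin (- (t / 2)) by apply: sin_gt0_pi; apply/andP; split; lra.
  by rewrite sinN s0 oppr0 ltxx.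
have : 0 < sin (t / 2) by apply: sin_gt0_pi; apply/andP; split; lra.
by rewrite s0 ltxx.
Qed.

(* The signs of cross u v, cross v w and cross u w determine whether adding the
   angles from u to v and from v to w leaves the interval (-pi, pi].  In the
   second case z = 0 is included because the angle between opposite vectors is
   pi, not -pi. *)
Definition wraps (x y z : R) : R :=
  if [&& 0 < x, 0 < y & z < 0] then 1
  else if [&& x < 0, y < 0 & 0 <= z] then -1 else 0.

Lemma vangleD u v w : cross u v != 0 -> cross v w != 0 ->
  vangle u v + vangle v w - vangle u w =
    2 * pi * wraps (cross u v) (cross v w) (cross u w).
Proof.
move=> uv vw; have [u0 v0] := cross_neq0 uv; have [_ w0] := cross_neq0 vw.
have c1 := cos_vangleD u0 v0 w0.
have [b1 b2 _] := vangleP u0 w0; have pi0 := pi_gt0 R.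
(* [lo], [up] and [dn] treat open windows of length [4 * pi] centred at 0, [2 * pi] and
   [- (2 * pi)]: the only multiple of [2 * pi] inside is the centre. The signs of the cross products
   decide which window applies. *)
have lo t : - (2 * pi) < t -> t < 2 * pi -> cos t = 1 -> t = 2 * pi * 0.
  by move=> t1 t2 ct; rewrite mulr0; apply: cos_eq1 => //; rewrite t1.
have up t : 0 < t -> t < 2 * pi + 2 * pi -> cos t = 1 -> t = 2 * pi * 1.
  move=> t1 t2 ct; suff : t - pi *+ 2 = 0 by rewrite mulr2n; lra.
  apply: cos_eq1; first by rewrite mulr2n; apply/andP; split; lra.
  by rewrite -(cosD2pi (t - pi *+ 2)) subrK.
have dn t : - (2 * pi + 2 * pi) < t -> t < 0 -> cos t = 1 -> t = 2 * pi * -1.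
  move=> t1 t2 ct; suff : t + pi *+ 2 = 0 by rewrite mulr2n; lra.
  by apply: cos_eq1; rewrite ?cosD2pi // mulr2n; apply/andP; split; lra.
rewrite /wraps.
have [x|x|x] := ltgtP 0 (cross u v); last by rewrite -x eqxx in uv.
- have /andP[a1 a2] := vangle_gt0 x.
  have [y|y|y] := ltgtP 0 (cross v w); last by rewrite -y eqxx in vw.
  + have /andP[a3 a4] := vangle_gt0 y.
    case: ltP => /= z; last by have a5 := vangle_ge0 u0 w0 z; apply: lo => //; lra.
    by have /andP[a5 a6] := vangle_lt0 z; apply: up => //; lra.
  + have /andP[a3 a4] := vangle_lt0 y; rewrite /=.
    by apply: lo => //; lra.
- have /andP[a1 a2] := vangle_lt0 x; rewrite /=.
  have [y|y|y] := ltgtP 0 (cross v w); last by rewrite -y eqxx in vw.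
  + have /andP[a3 a4] := vangle_gt0 y; rewrite /=.
    by apply: lo => //; lra.
  + have /andP[a3 a4] := vangle_lt0 y; rewrite /=.
    case: leP => /= z; last by have /andP[a5 a6] := vangle_lt0 z; apply: lo => //; lra.
    by have a5 := vangle_ge0 u0 w0 z; apply: dn => //; lra.
Qed.

(** * The angle sum of a quadrilateral *)

Lemma vangleN u v : vangle (- u) (- v) = vangle u v.
Proof.
rewrite /vangle; congr (xget 0); apply/seteqP; split => t [tpi [k k0 vE]];
  split=> //; exists k => //; apply: row2P; move/rowP: vE => vE;
  move: (vE 0) (vE 1); rewrite !mxE /= => h1 h2; lra.
Qed.

Lemma vangle_refl u : u != 0 -> vangle u u = 0.
Proof.
move=> u0; have := cos_vangleD u0 u0 u0; rewrite addrK => /cos_eq1; apply.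
by have [t1 t2 _] := vangleP u0 u0; have pi0 := pi_gt0 R; apply/andP; split; lra.
Qed.

(** The two products test whether the line AB strictly separates P from Q, and whether the line PQ
    strictly separates A from B. *)
Definition signed_crossing A B P Q : R :=
  if (cross (A - P) (B - P) * cross (A - Q) (B - Q) < 0) &&
     (cross (A - P) (A - Q) * cross (B - P) (B - Q) < 0)
  then (if cross (A - P) (B - P) < 0 then 1 else -1) else 0.

(* The left-hand side is the sum of the oriented angles of the quadrilateral
   APBQ; signed_crossing A B P Q is 0 unless this quadrilateral is convex. *)
Lemma quadrilateral_angle_sum A B P Q :
  cross (A - P) (B - P) != 0 -> cross (A - Q) (B - Q) != 0 ->
  cross (A - P) (A - Q) != 0 -> cross (B - P) (B - Q) != 0 ->
  @angle R A Q B - angle A P B - (angle P B Q - angle P A Q) =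
    2 * pi * signed_crossing A B P Q.
Proof.
rewrite !angleE -[P - B]opprB -[Q - B]opprB -[P - A]opprB -[Q - A]opprB !vangleN.
rewrite /signed_crossing.
have : B - Q = (B - P) + (A - Q) - (A - P) by apply: row2P; rewrite !mxE; ring.
move: (A - P) (B - P) (A - Q) (B - Q) => a b c d dE x2 y1 x1 y2.
(* Compare the routes from [a] to [d] via [c] and via [b]; the direct angle from [a] to [d]
   cancels. *)
transitivity (2 * pi * (wraps (cross a c) (cross c d) (cross a d) -
                        wraps (cross a b) (cross b d) (cross a d))).
  by rewrite mulrBr -!vangleD //; lra.
(* These linear relations exclude the sign patterns in which the two sides would differ. *)
have E1 : cross a d = cross a b + cross a c by rewrite dE /cross !mxE; ring.
have E2 : cross c d + cross b d = cross a b + cross a c.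
  by rewrite dE /cross !mxE; ring.
congr (_ * _); rewrite /wraps E1 leNgt; move: x2 y1 x1 y2 E2.
move: (cross a b) (cross c d) (cross a c) (cross b d) => x2 y1 x1 y2.
move=> n1 n2 n3 n4 E2; move: n1 n2 n3 n4.
case: (ltgtP x2 0) => // a1 _; case: (ltgtP y1 0) => // a2 _;
case: (ltgtP x1 0) => // a3 _; case: (ltgtP y2 0) => // a4 _;
rewrite ?(pmulr_rlt0 _ a1) ?(nmulr_rlt0 _ a1) ?(pmulr_rlt0 _ a3) ?(nmulr_rlt0 _ a3);
rewrite ?a2 ?a4 ?(lt_gtF a2) ?(lt_gtF a4) /=; case: (ltP (x2 + x1) 0) => /= z; lra.
Qed.

End Vectors.

(** * Crossing segments, and the change of the winding number along [p] *)

Section Polygons.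
Variable R : realType.
Implicit Types (A B P Q O X : plane R) (l p s : seq (plane R)).

Lemma cross_subC A B X : cross (A - X) (B - X) = cross (X - A) (X - B).
Proof. by rewrite /cross !mxE; ring. Qed.

(** The function [cross (X - P) (X - Q)] is affine in X and vanishes at the common point. The case
    [A = B] is included: there the conclusion is absurd, so the segments do not meet. *)
Lemma segments_meet_opposite A B P Q :
  segment A B `&` segment P Q !=set0 ->
  cross (A - P) (A - Q) != 0 -> cross (B - P) (B - Q) != 0 ->
  cross (A - P) (A - Q) * cross (B - P) (B - Q) < 0.
Proof.
move=> [X [[t /andP[t0 t1] XE] [s _ XF]]] xA xB.
have : (1 - t) * cross (A - P) (A - Q) + t * cross (B - P) (B - Q) = 0.
  have : cross (A + t *: (B - A) - P) (P - Q) = 0.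
    by rewrite -XE XF /cross !mxE; ring.
  by rewrite /cross !mxE => <-; ring.
move: xA xB; case: (ltgtP (cross (A - P) (A - Q)) 0) => // a _;
  case: (ltgtP (cross (B - P) (B - Q)) 0) => // b _ E.
- by move: E; nra.
- by rewrite nmulr_rlt0.
- by rewrite pmulr_rlt0.
- by move: E; nra.
Qed.

Lemma segments_meetP A B P Q :
  cross (A - P) (B - P) != 0 -> cross (A - Q) (B - Q) != 0 ->
  cross (A - P) (A - Q) != 0 -> cross (B - P) (B - Q) != 0 ->
  segment A B `&` segment P Q !=set0 <->
  (cross (A - P) (B - P) * cross (A - Q) (B - Q) < 0) &&
  (cross (A - P) (A - Q) * cross (B - P) (B - Q) < 0).
Proof.
move=> x2 y1 x1 y2; split=> [m|].
  rewrite (segments_meet_opposite m) // andbT.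
  rewrite ![cross (A - _) (B - _)]cross_subC.
  by rewrite segments_meet_opposite -?cross_subC // setIC.
have E : cross (A - P) (A - Q) - cross (B - P) (B - Q) =
         cross (A - Q) (B - Q) - cross (A - P) (B - P).
  by rewrite /cross !mxE; ring.
(* By [E], a single denominator serves for the parameters of the intersection point on both
   segments. *)
set D := _ - _ in E.
move=> /andP[h1 h2].
have [D0 ts] : D != 0 /\ (0 <= cross (A - P) (A - Q) / D <= 1 /\
                          0 <= - cross (A - P) (B - P) / D <= 1).
  move: x2 x1 h1 h2 E; rewrite /D.
  move: (cross (A - P) (B - P)) (cross (A - Q) (B - Q)) => p q.
  move: (cross (A - P) (A - Q)) (cross (B - P) (B - Q)) => r s.
  case: (ltgtP p 0) => // a _; case: (ltgtP r 0) => // b _;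
    rewrite ?(pmulr_rlt0 _ a) ?(nmulr_rlt0 _ a) ?(pmulr_rlt0 _ b) ?(nmulr_rlt0 _ b);
    move=> c d E; try by exfalso; lra.
  - have D0 : 0 < r - s by lra.
    rewrite gt_eqF // !ler_pdivlMr // !ler_pdivrMr //.
    by split=> //; split; apply/andP; split; lra.
  - have D0 : r - s < 0 by lra.
    rewrite lt_eqF // !ler_ndivlMr // !ler_ndivrMr //.
    by split=> //; split; apply/andP; split; lra.
exists (A + (cross (A - P) (A - Q) / D) *: (B - A)); split.
  by exists (cross (A - P) (A - Q) / D) => //; case: ts.
exists (- cross (A - P) (B - P) / D); first by case: ts.
by move: D0; rewrite /D /cross !mxE => D0; apply: row2P; rewrite !mxE; field.
Qed.

Lemma clockwiseE A B P : clockwise A B P = (cross (A - P) (B - P) < 0).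
Proof.
by rewrite /clockwise; congr (_ < 0); rewrite /cross !mxE; ring.
Qed.

Lemma quadrilateral_intersection A B P Q :
  cross (A - P) (A - Q) != 0 -> cross (B - P) (B - Q) != 0 ->
  (A <> B -> cross (A - P) (B - P) != 0 /\ cross (A - Q) (B - Q) != 0) ->
  @angle R A Q B - angle A P B - (angle P B Q - angle P A Q) =
    2 * pi * (if `[< segment A B `&` segment P Q !=set0 >]
              then crossing_sign A B P else 0)%:~R.
Proof.
(* A degenerate edge occurs when [l] has a single vertex; its angles vanish and it misses PQ. *)
move=> x1 y2 nAB; have [AB|/eqP/nAB[x2 y1]] := eqVneq A B.
  rewrite -AB in y2 *; rewrite asboolF ?mulr0; last first.
    by move=> m; have := segments_meet_opposite m x1 y2; rewrite -expr2; nra.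
  have [u0 v0] := cross_neq0 x1.
  by rewrite subrr subr0 !angleE !vangle_refl // subrr.
rewrite quadrilateral_angle_sum // /signed_crossing /crossing_sign clockwiseE.
rewrite (asbool_equiv_eq (segments_meetP x2 y1 x1 y2)) asboolb.
by case: ifP => // _; case: ifP; rewrite ?mulrN1z.
Qed.

(** The final points of the edges are a permutation of the initial ones. *)
Lemma sum_closed_edges (g : plane R -> R) l :
  \sum_(e <- closed_edges l) (g e.2 - g e.1) = 0.
Proof.
rewrite sumrB /closed_edges -(big_map snd predT g) -(big_map fst predT g).
rewrite -/unzip1 -/unzip2 unzip1_zip ?unzip2_zip ?size_rot //.
by rewrite (perm_big l) ?perm_rot //= subrr.
Qed.

Lemma mem_closed_edges l e : e \in closed_edges l -> e.1 \in l /\ e.2 \in l.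
Proof.
case: e => A B /= h; split.
  by rewrite -[l](@unzip1_zip _ _ _ (rot 1 l)) ?size_rot //; apply: (map_f fst h).
by rewrite -(mem_rot 1) -[rot 1 l](@unzip2_zip _ _ l) ?size_rot //; apply: (map_f snd h).
Qed.

Lemma winding_across_edge l P Q :
  (forall A, A \in l -> cross (A - P) (A - Q) != 0) ->
  (forall A B, A \in l -> B \in l -> A <> B ->
     cross (A - P) (B - P) != 0 /\ cross (A - Q) (B - Q) != 0) ->
  winding l Q - winding l P =
    \sum_(e <- closed_edges l)
      (if `[< segment e.1 e.2 `&` segment P Q !=set0 >]
       then crossing_sign e.1 e.2 P else 0)%:~R.
Proof.
move=> lPQ lAB; rewrite /winding -mulrBr -sumrB.
(* The subtracted 0 is the telescoping sum of [angle P B Q - angle P A Q], which completes each edge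
   to a quadrilateral. *)
rewrite -[X in _ * X]subr0.
rewrite -[X in _ - X](sum_closed_edges (fun X => angle P X Q) l) -sumrB.
rewrite mulr_sumr; apply: eq_big_seq => e /mem_closed_edges[e1 e2].
rewrite quadrilateral_intersection ?mulKf ?lPQ //; last exact: lAB.
by rewrite mulf_neq0 ?gt_eqF ?pi_gt0.
Qed.

Lemma sum_edges (V : zmodType) (g : plane R -> V) x p :
  \sum_(e <- edges (x :: p)) (g e.2 - g e.1) = g (last x p) - g x.
Proof.
elim: p x => [|y p IH] x; first by rewrite /edges /= big_nil subrr.
by rewrite /edges /= big_cons -/(edges (y :: p)) IH addrC subrKA.
Qed.

Lemma mem_edges p e : uniq p -> e \in edges p ->
  [/\ e.1 \in p, e.2 \in p & e.1 <> e.2].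
Proof.
elim: p => [//|x [//|y p] IH] /andP[xp up].
rewrite /edges /= in_cons -/(edges (y :: p)) => /predU1P[->|/(IH up)[h1 h2 h3]].
  split; rewrite ?in_cons ?eqxx ?orbT //= => xy.
  by move: xp; rewrite xy in_cons eqxx.
by split; rewrite // in_cons ?h1 ?h2 orbT.
Qed.

Lemma cross_eq0_collinear A B C : A <> C -> cross (A - C) (B - C) = 0 ->
  @collinear R A B C.
Proof.
move=> /eqP AC c0; exists C, (A - C); rewrite subr_eq0; split => //.
- by exists 1; rewrite scale1r subrKC.
- have d := lt0r_neq0 (@dot_gt0 R (A - C) _); rewrite subr_eq0 in d.
  have {}d := d AC; exists (dot (A - C) (B - C) / dot (A - C) (A - C)).
  (* For [u = A - C] and [v = B - C], the vector [dot u u *: v] is [dot u v *: u] plus [cross u v]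
     times [u] turned by a right angle; the last term is zero here. *)
  have E i : (B - C) 0 i * dot (A - C) (A - C) =
    dot (A - C) (B - C) * (A - C) 0 i.
    have [->|->] : i = 0 \/ i = 1.
      by case: i => [[|[|//]] ?]; [left|right]; apply: val_inj.
    + move: c0; move: (A - C) (B - C) => u v; rewrite /cross /dot => c0.
      transitivity ((u 0 0 * v 0 0 + u 0 1 * v 0 1) * u 0 0 -
        (u 0 0 * v 0 1 - u 0 1 * v 0 0) * u 0 1); first by ring.
      by rewrite c0 mul0r subr0.
    + move: c0; move: (A - C) (B - C) => u v; rewrite /cross /dot => c0.
      transitivity ((u 0 0 * v 0 0 + u 0 1 * v 0 1) * u 0 1 +
        (u 0 0 * v 0 1 - u 0 1 * v 0 0) * u 0 0); first by ring.
      by rewrite c0 mul0r addr0.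
  rewrite addrC; apply/eqP; rewrite -subr_eq; apply/eqP/rowP => i.
  by apply: (mulIf d); rewrite E [in RHS]mxE mulrAC divfK.
- by exists 0; rewrite scale0r addr0.
Qed.

Lemma general_position_cross (S : set (plane R)) A B C : general_position S ->
  S A -> S B -> S C -> A <> B -> B <> C -> A <> C -> cross (A - C) (B - C) != 0.
Proof.
move=> [gp _] SA SB SC AB BC AC; apply/eqP => /(cross_eq0_collinear AC).
exact: gp.
Qed.

Lemma winding_difference l p : (0 < size p)%N -> uniq (l ++ p) ->
  general_position [set` l ++ p] ->
  winding l (last 0 p) - winding l (head 0 p) = (intersection_number l p)%:~R.
Proof.
case: p => [//|x p] _; set q := x :: p; rewrite cat_uniq => /and3P[_ /hasPn lq uq] gp.
have {}lq A X : A \in l -> X \in q -> A <> X.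
  by move=> Al /lq/negP Xl AX; apply: Xl; rewrite -AX.
(* Telescoping along [p] leaves one edge of [p] at a time. *)
transitivity (\sum_(f <- edges q) (winding l f.2 - winding l f.1)).
  by rewrite sum_edges.
rewrite /intersection_number exchange_big /= (rmorph_sum intr) /=.
apply: eq_big_seq => f /(mem_edges uq)[f1 f2 f12].
rewrite (rmorph_sum intr) /=; apply: winding_across_edge.
- move=> A Al; rewrite -cross_subC.
  apply: (general_position_cross gp); rewrite /= ?mem_cat ?Al ?f1 ?f2 ?orbT //.
    exact/nesym/lq.
  exact/nesym/lq.
- move=> A B Al Bl AB.
  by split; apply: (general_position_cross gp);
    rewrite /= ?mem_cat ?Al ?Bl ?f1 ?f2 ?orbT //; apply: lq.
Qed.

End Polygons.

(** * Separating a point from [l], and vanishing of the winding number *)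

Section Separation.
Variable R : realType.
Implicit Types (u v w : plane R) (A B C P Q O X : plane R) (l p s : seq (plane R)).

Lemma winding_half_plane u l O :
  (forall A, A \in l -> 0 < dot u (A - O)) -> winding l O = 0.
Proof.
move=> ul; rewrite /winding.
rewrite [X in _ * X](_ : _ = \sum_(e <- closed_edges l)
    (vangle u (e.2 - O) - vangle u (e.1 - O))); last first.
  apply: eq_big_seq => -[A B] /mem_closed_edges[/= Al Bl]; rewrite angleE.
  have dotr0 w : 0 < dot u w -> w != 0.
    by apply: contraTneq => ->; rewrite /dot !mxE !mulr0 addr0 ltxx.
  have u0 : u != 0.
    by apply: contraTneq (ul A Al) => ->; rewrite /dot !mxE !mul0r addr0 ltxx.
  have [A0 B0] := (dotr0 _ (ul A Al), dotr0 _ (ul B Bl)).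
  have [/andP[a1 a2] /andP[b1 b2]] :=
    (vangle_lt_pihalf u0 (ul A Al), vangle_lt_pihalf u0 (ul B Bl)).
  have [c1 c2 _] := vangleP A0 B0.
  have /cos_eq1 := cos_vangleD u0 A0 B0; have pi0 := pi_gt0 R.
  suff h : - (2 * pi) < vangle u (A - O) + vangle (A - O) (B - O) - vangle u (B - O)
     < 2 * pi by move=> /(_ h); lra.
  by apply/andP; split; lra.
by rewrite (sum_closed_edges (fun X => vangle u (X - O))) mulr0.
Qed.

(** When [0 < cross u v], this is the closed convex cone spanned by [u] and [v]. *)
Definition in_cone u v w := 0 <= cross u w /\ 0 <= cross w v.

(** By Cramer's rule [cross u v *: w] equals [cross w v *: u + cross u w *: v]; pair this with [a]
    and [b]. *)
Lemma in_cone_trans u v a b w : 0 < cross u v -> in_cone a b u -> in_cone a b v ->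
  in_cone u v w -> in_cone a b w.
Proof.
move=> uv [au ub] [av vb] [uw wv].
have E c : cross u v * cross c w = cross w v * cross c u + cross u w * cross c v.
  by rewrite /cross; ring.
split; rewrite -(pmulr_rge0 _ uv).
  by rewrite E addr_ge0 ?mulr_ge0.
have -> : cross w b = - cross b w by rewrite /cross; ring.
have -> : cross u v * - cross b w = cross w v * cross u b + cross u w * cross v b.
  by rewrite /cross; ring.
by rewrite addr_ge0 ?mulr_ge0.
Qed.

(* Adding the vectors one at a time, the cone they span stays salient until some
   new vector is opposite to it, and then 0 is in the interior of a triangle. *)
Lemma salient_cone_or_triangle u v s : 0 < cross u v ->
  (forall a b, a \in [:: u, v & s] -> b \in [:: u, v & s] -> a <> b -> cross a b != 0) ->
  (exists a b, 0 < cross a b /\ forall w, w \in [:: u, v & s] -> in_cone a b w) \/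
  (exists a b c, [/\ a \in [:: u, v & s], b \in [:: u, v & s], c \in [:: u, v & s],
     0 < cross a b & 0 < cross b c /\ 0 < cross c a]).
Proof.
have crr w : cross w w = 0 by rewrite /cross; ring.
have crC a b : cross a b = - cross b a by rewrite /cross; ring.
elim: s u v => [|w s IH] u v uv nz.
  left; exists u, v; split=> // w; rewrite !inE /in_cone => /orP[]/eqP->;
  by split; rewrite ?crr // ltW.
have sub a b : a \in [:: u, v & w :: s] -> b \in [:: u, v & w :: s] ->
  {subset [:: a, b & s] <= [:: u, v & w :: s]}.
  move=> ha hb x; rewrite !in_cons => /or3P[/eqP->|/eqP->|xs]; rewrite ?xs ?orbT //.
have [iu iv iw] : [/\ u \in [:: u, v & w :: s], v \in [:: u, v & w :: s] &
                      w \in [:: u, v & w :: s]].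
  by split; rewrite !in_cons eqxx ?orbT.
(* Once a cone spanned by two of the vectors contains [u], [v] and [w], its generators replace all
   three in the induction. *)
have rec a b : 0 < cross a b -> a \in [:: u, v & w :: s] -> b \in [:: u, v & w :: s] ->
  in_cone a b u -> in_cone a b v -> in_cone a b w ->
  (exists a b, 0 < cross a b /\ forall x, x \in [:: u, v & w :: s] -> in_cone a b x) \/
  (exists a b c, [/\ a \in [:: u, v & w :: s], b \in [:: u, v & w :: s],
     c \in [:: u, v & w :: s], 0 < cross a b & 0 < cross b c /\ 0 < cross c a]).
  move=> ab ia ib cu cv cw; have sab := sub a b ia ib.
  have [|[c [d [cd h]]]|[c [d [e [ic id' ie x y]]]]] := IH a b ab.
  - by move=> x y /sab xl /sab yl; apply: nz.
  - left; exists c, d; split=> // x.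
    have [ca cb] : in_cone c d a /\ in_cone c d b.
      by split; apply: h; rewrite !in_cons eqxx ?orbT.
    rewrite !in_cons => /or4P[/eqP->|/eqP->|/eqP->|xs];
      try exact: in_cone_trans ab ca cb _.
    by apply: h; rewrite !in_cons xs !orbT.
  - by right; exists c, d, e; split=> //; apply: sab.
have wk a b c : 0 <= cross a c -> 0 <= cross c b -> in_cone a b c by [].
have [wu|/eqP wu] := eqVneq w u.
  by apply: (rec u v) => //; apply: wk; rewrite ?wu ?crr // ltW.
have [wv|/eqP wv] := eqVneq w v.
  by apply: (rec u v) => //; apply: wk; rewrite ?wv ?crr // ltW.
have cu := nz _ _ iu iw (nesym wu); have cv := nz _ _ iw iv wv.
(* In order: [w] is opposite to the cone and closes a triangle, extends it beyond [u], extends it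
   beyond [v], or lies inside it. *)
move: cu cv; case: (ltgtP (cross u w) 0) => // cu _;
  case: (ltgtP (cross w v) 0) => // cv _.
- by right; exists u, v, w; split=> //; split; rewrite crC oppr_gt0.
- have wu0 : 0 < cross w u by rewrite crC oppr_gt0.
  by apply: (rec w v) => //; apply: wk; rewrite ?crr // ltW.
- have vw0 : 0 < cross v w by rewrite crC oppr_gt0.
  by apply: (rec u w) => //; apply: wk; rewrite ?crr // ltW.
- by apply: (rec u v) => //; apply: wk; rewrite ?crr // ltW.
Qed.

Lemma mem_polygon l A : A \in l -> polygon l A.
Proof.
move=> Al; have : A \in unzip1 (closed_edges l) by rewrite unzip1_zip ?size_rot.
move=> /mapP[e el ->]; exists e => //; exists 0; first by rewrite lexx ler01.
by rewrite scale0r addr0.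
Qed.

(** Two binary combinations: first A with B, then the result with C. *)
Lemma convex_set_triangle (S : set (plane R)) A B C (a b c : R) :
  convex_set S -> S A -> S B -> S C -> 0 < a -> 0 < b -> 0 < c -> a + b + c = 1 ->
  S (a *: A + b *: B + c *: C).
Proof.
move=> cS SA SB SC a0 b0 c0 abc.
have cv X Y (t : R) : S X -> S Y -> 0 <= t <= 1 -> S (t *: X + (1 - t) *: Y).
  move=> SX SY /andP[t0 t1].
  by have := cS X Y (Itv01 t0 t1); rewrite !inE; apply.
have ab0 : 0 < a + b by rewrite addr_gt0.
have -> : a *: A + b *: B + c *: C =
    (a + b) *: ((a / (a + b)) *: A + (1 - a / (a + b)) *: B) + (1 - (a + b)) *: C.
  have -> : c = 1 - (a + b) by lra.
  by apply: row2P; rewrite !mxE; field; rewrite gt_eqF.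
apply: (cv) => //; last by apply/andP; split; lra.
apply: (cv) => //; rewrite ler_pdivlMr // ler_pdivrMr //; apply/andP; split; lra.
Qed.

Lemma separate_from_hull l O : (0 < size l)%N ->
  (forall A, A \in l -> A <> O) ->
  (forall A B, A \in l -> B \in l -> A <> B -> cross (A - O) (B - O) != 0) ->
  ~ convex_hull (polygon l) O ->
  exists u, forall A, A \in l -> 0 < dot u (A - O).
Proof.
move=> l0 lO nz hO.
have [[A Al AA]|[A [B [Al Bl AB]]]] : (exists2 A, A \in l & forall B, B \in l -> B = A) \/
    exists A B, [/\ A \in l, B \in l & 0 < cross (A - O) (B - O)].
  case: l l0 {lO hO} nz => [//|A l] _ nz; have Al : A \in A :: l by rewrite mem_head.
  have [h|/allPn[B Bl /eqP BA]] := boolP (all (pred1 A) l).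
    by left; exists A => // B; rewrite in_cons => /predU1P[//|/(allP h)/eqP].
  have {}Bl : B \in A :: l by rewrite in_cons Bl orbT.
  right; have := nz _ _ Al Bl (nesym BA); case: ltgtP => // c _.
    by exists B, A; split=> //; move: c; rewrite /cross; lra.
  by exists A, B.
- exists (A - O) => B /AA ->; apply: dot_gt0; rewrite subr_eq0.
  exact/eqP/lO.
have inl x : x \in [:: A - O, B - O & [seq C - O | C <- l]] ->
    exists2 C, C \in l & x = C - O.
  by rewrite !in_cons => /or3P[/eqP->|/eqP->|/mapP//]; [exists A|exists B].
have [x y /inl[C Cl ->] /inl[D Dl ->] CD||] :=
    @salient_cone_or_triangle (A - O) (B - O) [seq C - O | C <- l] AB.
- by apply: nz => // E; apply: CD; rewrite E.
- move=> [a [b [ab cone]]].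
  (* This is [b - a] turned clockwise by a right angle. Its product with [w] is
     [cross a w + cross w b], positive on the cone except at 0. *)
  exists (\row_(j < 2) if j == 0 then b 0 1 - a 0 1 else a 0 0 - b 0 0) => C Cl.
  have [aC bC] : in_cone a b (C - O).
    by apply: cone; rewrite !in_cons (map_f (fun C => C - O)) ?orbT.
  rewrite (_ : dot _ _ = cross a (C - O) + cross (C - O) b); last first.
    by rewrite /dot /cross !mxE /=; ring.
  rewrite lt_def addr_ge0 // andbT paddr_eq0 //; apply/negP => /andP[/eqP a0 /eqP b0].
  apply: (lO C Cl); apply/eqP; rewrite -subr_eq0; apply/eqP.
  have ab0 := lt0r_neq0 ab; apply: (scalerI ab0).
  move: (C - O) a0 b0 => w a0 b0.
  transitivity (cross w b *: a + cross a w *: b); last first.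
    by rewrite a0 b0 !scale0r addr0 scaler0.
  by apply: row2P; rewrite /cross !mxE; ring.
- move=> [_ [_ [_ [/inl[C Cl ->] /inl[D Dl ->] /inl[E El ->] c1 [c2 c3]]]]].
  case: hO => S [cS lS].
  set t := cross (D - O) (E - O) + cross (E - O) (C - O) + cross (C - O) (D - O).
  have t0 : 0 < t by rewrite addr_gt0 // addr_gt0.
  have t0' := lt0r_neq0 t0.
  (* Barycentric coordinates of O in the triangle CDE, as ratios of signed areas. *)
  rewrite (_ : O = (cross (D - O) (E - O) / t) *: C + (cross (E - O) (C - O) / t) *: D
                 + (cross (C - O) (D - O) / t) *: E); last first.
    move: t0'; rewrite /t /cross !mxE => t0'.
    by apply: row2P; rewrite !mxE; field.
  apply: convex_set_triangle; rewrite ?divr_gt0 //; try by apply/lS/mem_polygon.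
  by rewrite -!mulrDl divff.
Qed.

Lemma lt_dist_dot A B O : dist A O < dist A B ->
  dot (O - A) (O - A) < dot (B - A) (B - A).
Proof.
rewrite /dist => h; have {h} : Num.sqrt ((A 0 0 - O 0 0) ^+ 2 + (A 0 1 - O 0 1) ^+ 2) ^+ 2 <
  Num.sqrt ((A 0 0 - B 0 0) ^+ 2 + (A 0 1 - B 0 1) ^+ 2) ^+ 2.
  by rewrite ltrXn2r // sqrtr_ge0.
by rewrite !sqr_sqrtr ?addr_ge0 ?sqr_ge0 // /dot !mxE; lra.
Qed.

(** Expanding the square of the length of [(C - O) + (A - C)], which is nonnegative, bounds twice
    the product below by the difference of the squared distances from C to O and to A. *)
Lemma separate_from_ball l C O : (forall A, A \in l -> dist C A < dist C O) ->
  forall A, A \in l -> 0 < dot (C - O) (A - O).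
Proof.
move=> lC A /lC/lt_dist_dot; rewrite /dot !mxE => h.
have := sqr_ge0 (C 0 0 - O 0 0 + (A 0 0 - C 0 0)).
have := sqr_ge0 (C 0 1 - O 0 1 + (A 0 1 - C 0 1)).
by move: h; nra.
Qed.

Lemma distC A B : dist A B = dist B A.
Proof. by rewrite /dist; congr Num.sqrt; ring. Qed.

End Separation.

Theorem mainTheorem4 (R : realType) (l : seq (plane R)) (hl : (0 < size l)%N) :
  (forall p : seq (plane R), (0 < size p)%N ->
     uniq (l ++ p) -> general_position [set` l ++ p] ->
     let P0 := head 0 p in
     let P1 := last 0 p in
     winding l P1 - winding l P0 = (intersection_number l p)%:~R /\
     (~ convex_hull (polygon l) P0 ->
        winding l P1 = (intersection_number l p)%:~R)) /\
  (exists M : R, forall p : seq (plane R), (0 < size p)%N ->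
     uniq (l ++ p) -> general_position [set` l ++ p] ->
     let P0 := head 0 p in
     let P1 := last 0 p in
     (forall X, polygon l X -> M < dist P0 X) ->
     winding l P1 = (intersection_number l p)%:~R).
Proof.
split=> [p p0 ulp gp P0 P1|].
  split=> [|hP0]; first exact: winding_difference.
  rewrite -(winding_difference p0 ulp gp) -/P0 -/P1.
  have P0p : P0 \in p by rewrite /P0; case: (p) p0 => // *; rewrite mem_head.
  have lP0 A : A \in l -> A <> P0.
    move: ulp; rewrite cat_uniq => /and3P[_ /hasPn/(_ _ P0p)/negP P0l _] Al AP0.
    by apply: P0l; rewrite /= -AP0.
  have [|u ul] := separate_from_hull hl lP0 _ hP0.
    move=> A B Al Bl AB; apply: (general_position_cross gp) => //=;
      by rewrite ?mem_cat ?Al ?Bl ?P0p ?orbT //; apply: lP0.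
  by rewrite (winding_half_plane ul) subr0.
(* The sum of the distances from one vertex C bounds each of them, so all vertices are nearer to C
   than [P0] is. *)
set C := head 0 l; exists (\sum_(A <- l) dist C A) => p p0 ulp gp P0 P1 far.
rewrite -(winding_difference p0 ulp gp) -/P0 -/P1.
rewrite (@winding_half_plane _ (C - P0) l P0) ?subr0 //.
apply: separate_from_ball => A Al.
have Cl : C \in l by rewrite /C; case: (l) hl => // *; rewrite mem_head.
rewrite [ltRHS]distC; apply: le_lt_trans (far C (mem_polygon Cl)).
rewrite (big_rem A) //= lerDl sumr_ge0 // => B _; exact: sqrtr_ge0.
Qed.
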